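(* Let $m,r,n$ be integers with $0\le r\le m$, $m\ge1$ and $n\ge1$. For $0\le s\le m$ define $$Q_{m,s,r}(q)=\frac{\prod_{j=0}^{s}(1-q^{2m-2j+1})}{(1-q)^{s}(1-q^2)^{2s-2r}}\sum_{k=0}^{s}\frac{(-1)^{s-k}}{1-q^{2m-2k+1}}\left[\binom{2m-2r-1}{k}-\binom{2m-2r-1}{k-2r-2}\right]\sum_{i=0}^{s-k}\binom{m-s+i}{i}\left[\binom{m-k-i}{s-k-i}q^{2s-2k-2i}+\binom{m-k-i-1}{s-k-i-1}q^{2s-2k-2i-1}\right].$$ Then each $Q_{m,s,r}(q)\in\mathbb{Z}[q]$, and $$S_{2m-2r,n,r}(q)=\sum_{k=0}^{m}(-1)^kQ_{m,k,r}(q^{1/2})\frac{(1-q^{n+\frac12})(1-q^n)^{m-k}(1-q^{n+1})^{m-k}(1-q^{1/2})^kq^{kn}}{(1-q^{2r+2})(1-q)^{2m-2k-1}\prod_{i=0}^{k}(1-q^{m-i+\frac12})}.$$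
   Context: $q$ is an indeterminate and $q^{1/2}$ a fixed formal square root of $q$; identities are identities of rational functions in $q^{1/2}$. For integers $m$, $n\ge1$, $r\ge0$, $$S_{m,n,r}(q)=\sum_{k=1}^{n}\frac{1-q^{(2r+2)k}}{1-q^{2r+2}}\left(\frac{1-q^k}{1-q}\right)^{m-1}q^{\frac{m+2r+1}{2}(n-k)}.$$ Binomial coefficients $\binom{a}{b}$ with integers $a,b$ are taken to be $0$ when $b<0$ or when $0\le a<b$.
   Formalization: The identity for S_{2m-2r,n,r} is stated only for r < m, since it fails for r = m (e.g. m = r = n = 1, where the right side is 1 + 2q^{3/2}/((1+q)(1+q^2)) instead of 1); integrality of Q_{m,s,r} is kept for all 0 ≤ r ≤ m. *)

(* Defs.v *)
From HB Require Import structures.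
From mathcomp Require Import all_boot all_order all_algebra fraction.
Set Implicit Arguments. Unset Strict Implicit. Unset Printing Implicit Defensive.
Import Order.TTheory GRing.Theory Num.Theory.
Local Open Scope ring_scope.

(* Binomial coefficient with integer arguments: 0 when b < 0; the usual
   'C(a,b) when a >= 0 (hence 0 when 0 <= a < b); for a < 0 <= b the
   generalized binomial a(a-1)...(a-b+1)/b! = (-1)^b 'C(b-a-1, b). *)
Definition zbinom (a b : int) : int :=
  match b with
  | Negz _ => 0
  | Posz b' =>
      match a with
      | Posz a' => ('C(a', b'))%:Z
      | Negz a' => (-1) ^+ b' * ('C(b' + a', b'))%:Z
      end
  end.

Definition Sfun (F : fieldType) (m n r : nat) (t : F) : F :=
  let q := t ^+ 2 in
  \sum_(1 <= k < n.+1)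
     (1 - q ^+ ((2 * r + 2) * k)) / (1 - q ^+ (2 * r + 2))
     * ((1 - q ^+ k) / (1 - q)) ^ (m%:Z - 1)
     * t ^+ ((m + 2 * r + 1) * (n - k)).

Definition Qfun (F : fieldType) (m s r : nat) (x : F) : F :=
  (\prod_(j < s.+1) (1 - x ^+ (2 * m - 2 * j + 1)))
  / ((1 - x) ^+ s * (1 - x ^+ 2) ^ (2 * s%:Z - 2 * r%:Z))
  * \sum_(k < s.+1)
      ((-1) ^+ (s - k) / (1 - x ^+ (2 * m - 2 * k + 1))
       * (zbinom (2 * m%:Z - 2 * r%:Z - 1) k%:Z
          - zbinom (2 * m%:Z - 2 * r%:Z - 1) (k%:Z - 2 * r%:Z - 2))%:~R
       * \sum_(i < (s - k).+1)
           ('C(m - s + i, i))%:R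
           * ((zbinom (m%:Z - k%:Z - i%:Z) (s%:Z - k%:Z - i%:Z))%:~R
                * x ^ (2 * (s%:Z - k%:Z - i%:Z))
              + (zbinom (m%:Z - k%:Z - i%:Z - 1) (s%:Z - k%:Z - i%:Z - 1))%:~R
                * x ^ (2 * (s%:Z - k%:Z - i%:Z) - 1))).

(* The field of rational functions Q(t) over Z, t = q^{1/2}. *)
Notation ratfun := {fraction {poly int}}.
Definition polyfrac (p : {poly int}) : ratfun := @FracField.tofrac _ p.
Definition tvar : ratfun := polyfrac 'X.

(* Main.v *)
Require Import Defs.
From HB Require Import structures.
From mathcomp Require Import all_boot all_order all_algebra fraction.
From mathcomp Require Import ring zify.
Import Order.TTheory GRing.Theory Num.Theory.
Local Open Scope ring_scope.

(** Put [t = q^(1/2)], [y = q^n], [N = 2m-2r-1].  The coefficients [c_j] of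
    [(1 - u)^N (1 - u^(2r+2))] are symmetric under [j <-> 2m+1-j], so summing
    over [u = q^k] turns [S] into a combination, over [j <= m], of the quotients
    [y^j (1 - (ty)^(2m-2j+1)) / (1 - t^(2m-2j+1))].  Each numerator is expanded in powers
    of [B = (1-y)(1-t^2 y)] by
      [(1 - (ty)^(2M+1)) / (1 - ty) = \sum_s B^(M-s) y^s kern (M-s) s],
    where [kern p s] is the coefficient of [v^s] in
    [(1 + t v) / ((1 - v)(1 - t^2 v))^(p+1)]; this gives the expansion of [S].

    For integrality, only powers of [1 - q] must be cancelled, so it suffices to work in the
    ring of fractions without pole at [t = 1] and [t = -1].  Up to units the [Q_s] are the
    coefficients of a polynomial in [B / (y (1-q)^2)] whose values at [y = q^n], given by [S],
    lie in that ring, and the nodes have invertible differences there; interpolation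
    concludes. *)

(** * Convolution coefficients and the geometric sum built from them *)

Section Convolution.
Variables (R : comNzRingType) (a : R).

(* The coefficient of [v^s] in [1 / ((1 - v)^(p+1) (1 - a v)^(p'+1))]. *)
Definition bconv (p p' s : nat) : R :=
  \sum_(i < s.+1) 'C(p + i, i)%:R * ('C(p' + (s - i), s - i)%:R * a ^+ (s - i)).

Lemma bconv0 p p' : bconv p p' 0 = 1.
Proof. by rewrite /bconv big_ord1 /= !bin0 expr0 !mulr1. Qed.

(** Multiplying the generating function by 1 - v lowers p by one; [bconvSr] does the same for p'
    with 1 - a v. *)
Lemma bconvSl p p' s :
  bconv p.+1 p' s.+1 = bconv p.+1 p' s + bconv p p' s.+1.
Proof.
rewrite /bconv big_ord_recl [in X in _ = _ + X]big_ord_recl /= !bin0 addrCA -big_split.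
congr (_ + _); apply: eq_bigr => i _.
rewrite /bump /= add1n subSS -mulrDl -natrD; congr (_%:R * _).
by rewrite addnS binS addSnnS addnC.
Qed.

Lemma bconvSr p p' s :
  bconv p p'.+1 s.+1 = a * bconv p p'.+1 s + bconv p p' s.+1.
Proof.
rewrite /bconv big_ord_recr [in X in _ = _ + X]big_ord_recr /= subnn !bin0 addrA.
congr (_ + _); rewrite big_distrr -big_split; apply: eq_bigr => i _ /=.
have lt_is := ltn_ord i; rewrite subSn // exprS.
have -> : 'C(p'.+1 + (s - i).+1, (s - i).+1)
        = ('C(p'.+1 + (s - i), s - i) + 'C(p' + (s - i).+1, (s - i).+1))%N.
  by rewrite addnS binS addSnnS addnC.
rewrite natrD; ring.
Qed.

Definition bdiag p s := bconv p p s.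

Lemma bdiagS1 p : bdiag p.+1 1 = 1 + a + bdiag p 1.
Proof. by rewrite /bdiag bconvSl bconvSr !bconv0 mulr1 addrA. Qed.

(** Both factors are cleared at once: (1 - v)(1 - a v) = 1 - (1 + a) v + a v^2. *)
Lemma bdiagSS p s :
  bdiag p.+1 s.+2 = (1 + a) * bdiag p.+1 s.+1 - a * bdiag p.+1 s + bdiag p s.+2.
Proof.
rewrite /bdiag bconvSl [bconv p _ _]bconvSr.
have -> := bconvSl p p.+1 s; ring.
Qed.

Lemma bdiag0 s : bdiag 0 s = \sum_(i < s.+1) a ^+ i.
Proof.
rewrite /bdiag /bconv (reindex_inj rev_ord_inj); apply: eq_bigr => i _ /=.
by rewrite add0n subSS subKn -1?ltnS // !add0n !binn !mul1r.
Qed.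

Lemma bdiag0SS s : bdiag 0 s.+2 = (1 + a) * bdiag 0 s.+1 - a * bdiag 0 s.
Proof. rewrite !bdiag0 !(big_ord_recr _.+1) !(big_ord_recr s) /= !exprS; ring. Qed.

Variable y : R.
Let b : R := (1 - y) * (1 - a * y).

(** This is the coefficient of v^m in 1 / ((1 - y v)(1 - a y v) - b v), expanded in powers of b v.
    The denominator equals (1 - v)(1 - a y^2 v), whence the recurrence [bsumSS] and the closed form
    [bsumE]. *)
Definition bsum m := \sum_(s < m.+1) b ^+ (m - s) * y ^+ s * bdiag (m - s) s.

Lemma bsumSS m :
  bsum m.+2 = (1 + a * y ^+ 2) * bsum m.+1 - a * y ^+ 2 * bsum m.
Proof.
(* The terms s = 0, s = 1 and s = m + 2 are split off, since [bdiagSS] applies only to those in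
   between. *)
have E2 : bsum m.+2 = b ^+ m.+2 + b ^+ m.+1 * y * bdiag m.+1 1
   + \sum_(s < m) b ^+ (m - s) * y ^+ s.+2 * bdiag (m - s) s.+2
   + y ^+ m.+2 * bdiag 0 m.+2.
  rewrite /bsum big_ord_recr big_ord_recl big_ord_recl /= subnn /bump /=.
  rewrite /bdiag bconv0 expr0 !mulr1 mul1r !addrA; congr (_ + _ + _ + _).
have E1 : bsum m.+1 = b ^+ m.+1
   + \sum_(s < m) b ^+ (m - s) * y ^+ s.+1 * bdiag (m - s) s.+1
   + y ^+ m.+1 * bdiag 0 m.+1.
  rewrite /bsum big_ord_recr big_ord_recl /= subnn /bump /=.
  rewrite /bdiag bconv0 expr0 !mulr1 mul1r; congr (_ + _ + _).
have E1' : b * bsum m.+1 = b ^+ m.+2 + b ^+ m.+1 * y * bdiag m 1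
   + \sum_(s < m) b ^+ (m - s) * y ^+ s.+2 * bdiag (m - s).-1 s.+2.
  rewrite /bsum big_ord_recl big_ord_recl /= /bump /=.
  rewrite /bdiag bconv0 expr0 !mulr1 !mulrDr !addrA subn0 -exprS.
  rewrite !add1n subSS subn0 expr1 !mulrA -exprS; congr (_ + _ + _).
  rewrite big_distrr; apply: eq_bigr => i _ /=.
  by rewrite !add1n !subSS !mulrA -exprS -subnS subnSK.
have E0 : bsum m = \sum_(s < m) b ^+ (m - s) * y ^+ s * bdiag (m - s) s
   + y ^+ m * bdiag 0 m.
  by rewrite /bsum big_ord_recr /= subnn expr0 mul1r.
(* The b part supplies the term of [bdiagSS] with lowered p, the (1 + a) y part its term with factor
   1 + a. *)
have Hb : 1 + a * y ^+ 2 = b + (1 + a) * y by rewrite /b; ring.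
have ES : \sum_(s < m) b ^+ (m - s) * y ^+ s.+2 * bdiag (m - s) s.+2
  = (1 + a) * y * (\sum_(s < m) b ^+ (m - s) * y ^+ s.+1 * bdiag (m - s) s.+1)
  - a * y ^+ 2 * (\sum_(s < m) b ^+ (m - s) * y ^+ s * bdiag (m - s) s)
  + \sum_(s < m) b ^+ (m - s) * y ^+ s.+2 * bdiag (m - s).-1 s.+2.
  rewrite !big_distrr -sumrB -big_split; apply: eq_bigr => i _ /=.
  have := ltn_ord i; case: (m - i)%N (subn_gt0 i m) => [|d] <- // _ /=.
  rewrite bdiagSS !exprS; ring.
rewrite Hb mulrDl E1' E1 E2 E0 ES bdiagS1 bdiag0SS !exprS; ring.
Qed.

Lemma bsumE m : bsum m = \sum_(l < m.+1) (a * y ^+ 2) ^+ l.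
Proof.
suff: bsum m = \sum_(l < m.+1) (a * y ^+ 2) ^+ l
   /\ bsum m.+1 = \sum_(l < m.+2) (a * y ^+ 2) ^+ l by case.
elim: m => [|m [IH0 IH1]]; split => //.
- by rewrite /bsum !big_ord1 /bdiag bconv0 !expr0 !mulr1.
- rewrite /bsum !big_ord_recr !big_ord0 /= /bdiag bconv0 -/(bdiag 0 1) bdiag0.
  rewrite !big_ord_recr big_ord0 /= /b !expr0 !expr1; ring.
- rewrite bsumSS IH0 IH1 !(big_ord_recr m.+2) !(big_ord_recr m.+1) /= !exprS; ring.
Qed.

End Convolution.

Section Kernel.
Variables (R : comNzRingType) (x : R).

Definition kern (p s : nat) : R :=
  bdiag _ (x ^+ 2) p s + (if s is s'.+1 then x * bdiag _ (x ^+ 2) p s' else 0).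

(** The numerator 1 + x v adds x y times the sum for m - 1. By [bsumE] the two sums are the even and
    the odd powers of x y, together all exponents from 0 to 2m, and 1 - x y telescopes them. *)
Lemma kern_sum m y :
  (1 - x * y) * \sum_(s < m.+1) ((1 - y) * (1 - x ^+ 2 * y)) ^+ (m - s) * y ^+ s
                  * kern (m - s) s
  = 1 - (x * y) ^+ (2 * m).+1.
Proof.
have E : \sum_(s < m.+1) ((1 - y) * (1 - x ^+ 2 * y)) ^+ (m - s) * y ^+ s
                  * kern (m - s) s
  = bsum _ (x ^+ 2) y m + (if m is m'.+1 then x * y * bsum _ (x ^+ 2) y m' else 0).
  under eq_bigr do rewrite /kern mulrDr.
  rewrite big_split; congr (_ + _).
  case: m => [|m]; first by rewrite big_ord1 mulr0.
  rewrite big_ord_recl /= mulr0 add0r /bsum big_distrr; apply: eq_bigr => i _ /=.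
  rewrite /bump add1n subSS add0n (exprS y); ring.
rewrite {}E; case: m => [|m].
  by rewrite bsumE big_ord1 /= expr0 muln0 expr1 addr0 mulr1.
rewrite !bsumE -exprMn big_ord_recr /=; set U := \sum_(_ < _) _.
have HU : (1 - (x * y) ^+ 2) * U = 1 - (x * y) ^+ (2 * m.+1).
  rewrite exprM -{2}(expr1n _ m.+1) subrXX; congr (_ * _).
  by apply: eq_bigr => i _; rewrite expr1n mul1r.
have -> : (1 - x * y) * (U + ((x * y) ^+ 2) ^+ m.+1 + x * y * U)
 = (1 - (x * y) ^+ 2) * U + (1 - x * y) * ((x * y) ^+ 2) ^+ m.+1 by ring.
rewrite HU -exprM exprS; ring.
Qed.

End Kernel.

(** * The kernel transform of a coefficient sequence *)

Lemma exchange_triangle (V : nmodType) (m : nat) (f : nat -> nat -> V) :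
  \sum_(s < m.+1) \sum_(k < s.+1) f s k
  = \sum_(k < m.+1) \sum_(j < (m - k).+1) f (k + j)%N k.
Proof.
elim: m => [|m IH]; first by rewrite !big_ord1.
rewrite big_ord_recr IH [RHS]big_ord_recr /= subnn big_ord1 addn0.
rewrite [X in _ + X = _]big_ord_recr addrA -big_split /=; congr (_ + _).
apply: eq_bigr => k _ /=; have lt_km := ltn_ord k.
by rewrite subSn // [RHS]big_ord_recr /= addnS subnKC.
Qed.

Section KernelTransform.
Variables (F : fieldType) (t : F) (c : nat -> F) (m : nat).

Definition ktrans (s : nat) : F :=
  \sum_(k < s.+1) (-1) ^+ (s - k) / (1 - t ^+ (2 * m - 2 * k + 1)) * c k
                  * kern _ t (m - s) (s - k).

(** Each quotient of index k is expanded by [kern_sum] with m - k in place of m, and terms are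
    collected along s = k + j; the signs (-1)^s and (-1)^(s-k) combine to (-1)^k. *)
Lemma ktrans_sum y :
  (1 - t * y) * \sum_(s < m.+1) (-1) ^+ s * (((1 - y) * (1 - t ^+ 2 * y)) ^+ (m - s)
                                             * y ^+ s * ktrans s)
  = \sum_(k < m.+1) (-1) ^+ k * c k * (y ^+ k * (1 - (t * y) ^+ (2 * m - 2 * k + 1))
                                       / (1 - t ^+ (2 * m - 2 * k + 1))).
Proof.
set b := _ * (1 - _ * y).
under eq_bigr do rewrite 2!big_distrr /=.
rewrite (exchange_triangle _ m (fun s k => (-1) ^+ s * (b ^+ (m - s) * y ^+ s *
   ((-1) ^+ (s - k) / (1 - t ^+ (2 * m - 2 * k + 1)) * c k * kern _ t (m - s) (s - k))))).
rewrite big_distrr; apply: eq_bigr => k _ /=.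
have le_km : (k <= m)%N by rewrite -ltnS.
have -> : (2 * m - 2 * k + 1)%N = (2 * (m - k)).+1 by rewrite mulnBr addn1.
rewrite -kern_sum -/b !big_distrr big_distrl big_distrr; apply: eq_bigr => j _ /=.
have -> : (m - (k + j) = m - k - j)%N by rewrite subnDA.
have -> : (k + j - k = j)%N by rewrite addKn.
have -> : (-1) ^+ (k + j) = (-1) ^+ k * (-1) ^+ j :> F by rewrite exprD.
have sj : (-1) ^+ j * (-1) ^+ j = 1 :> F by rewrite -expr2 sqrr_sign.
rewrite exprD; set K := kern _ _ _ _.
transitivity ((-1) ^+ j * (-1) ^+ j * ((1 - t * y) *
  ((-1) ^+ k * (b ^+ (m - k - j) * (y ^+ k * y ^+ j) *
   (1 / (1 - t ^+ (2 * (m - k)).+1) * c k * K))))); first by ring.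
rewrite sj; ring.
Qed.

End KernelTransform.

(** * Coefficients of (1 - X)^N (1 - X^e) and their symmetry *)

Section AlternatingCoefficients.
Variables (N e : nat).

(* [(-1)^j altcoef j] is the coefficient of [X^j] in [(1 - X)^N (1 - X^e)], for even [e]. *)
Definition altcoef (j : nat) : int :=
  'C(N, j)%:Z - (if (j < e)%N then 0 else 'C(N, j - e)%:Z).

(** Without the alternating signs these are the coefficients of (1 + X)^N (1 - X^e), which changes
    sign when reversed in degree N + e. *)
Lemma altcoef_sym m j : (N + e = (2 * m).+1)%N -> (j <= m)%N ->
  altcoef ((2 * m).+1 - j) = - altcoef j.
Proof.
move=> hN le_jm; rewrite /altcoef opprB.
have [lt_je|le_ej] := ltnP j e.
  rewrite (bin_small (_ : N < _)%N) ?sub0r ?subr0; last by lia.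
  have [lt|le] := ltnP; first by rewrite bin_small; lia.
  congr (- (_%:Z)); have -> : ((2 * m).+1 - j - e = N - j)%N by lia.
  by rewrite bin_sub //; lia.
have -> : ((2 * m).+1 - j = N - (j - e))%N by lia.
rewrite bin_sub; last by lia.
have [lt|le] := ltnP; first by rewrite [X in _ = _ - X%:Z]bin_small ?subr0; lia.
have -> : (N - (j - e) - e = N - j)%N by lia.
by rewrite bin_sub //; lia.
Qed.

Lemma coef_1subX_exp (R : comNzRingType) j :
  ((1 - 'X) ^+ N : {poly R})`_j = (-1) ^+ j * 'C(N, j)%:R.
Proof.
have -> : (1 - 'X) ^+ N = \poly_(i < N.+1) ((-1) ^+ i * 'C(N, i)%:R) :> {poly R}.
  rewrite exprBn poly_def; apply: eq_bigr => i _.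
  rewrite expr1n mulr1 -mul_polyC polyCM rmorphXn rmorphN rmorph1 /= rmorph_nat.
  by rewrite -mulr_natr; ring.
rewrite coef_poly; case: ltnP => // le_Nj.
by rewrite bin_small ?mulr0.
Qed.

Lemma altcoef_horner (R : comNzRingType) m (u : R) :
  ~~ odd e -> (N + e = (2 * m).+1)%N ->
  \sum_(j < (2 * m).+2) (-1) ^+ j * (altcoef j)%:~R * u ^+ j
  = (1 - u) ^+ N * (1 - u ^+ e).
Proof.
move=> even_e hN; pose p : {poly R} := (1 - 'X) ^+ N * (1 - 'X^e).
have -> : (1 - u) ^+ N * (1 - u ^+ e) = p.[u] by rewrite /p !hornerE.
rewrite (@horner_coef_wide _ (2 * m).+2); last first.
  apply: leq_trans (size_polyMleq _ _) _.
  have s1 : (size (1 - 'X : {poly R})%R <= 2)%N.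
    by rewrite (leq_trans (size_polyD _ _)) // size_polyN size_polyX size_poly1.
  have s1N : (size ((1 - 'X) ^+ N : {poly R})%R <= N.+1)%N.
    apply: leq_trans (size_poly_exp_leq _ _) _; rewrite ltnS -[leqRHS]mul1n leq_mul2r.
    by rewrite -subn1 leq_subLR s1 orbT.
  have s2 : (size (1 - 'X^e : {poly R})%R <= e.+1)%N.
    by rewrite (leq_trans (size_polyD _ _)) // size_polyN size_polyXn size_poly1 geq_max ltnSn.
  by move: s1N s2 hN; lia.
apply: eq_bigr => j _; congr (_ * _).
rewrite /p mulrBr mulr1 coefB coefMXn !coef_1subX_exp /altcoef.
case: ltnP => le_ej; first by rewrite !subr0 -pmulrn.
rewrite intrB -!pmulrn mulrBr; congr (_ - _ * _); apply/esym.
by rewrite -[LHS]signr_odd -[RHS]signr_odd oddB // (negbTE even_e) addbF.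
Qed.

(** The terms j and 2m+1-j are paired: the sign from [altcoef_sym] cancels the one from the odd
    total 2m+1. *)
Lemma altcoef_horner_half (R : comNzRingType) m (u : R) :
  ~~ odd e -> (N + e = (2 * m).+1)%N ->
  \sum_(j < m.+1) (-1) ^+ j * (altcoef j)%:~R * (u ^+ j + u ^+ ((2 * m).+1 - j))
  = (1 - u) ^+ N * (1 - u ^+ e).
Proof.
move=> even_e hN; rewrite -(altcoef_horner _ m) //.
have -> : (2 * m).+2 = (m.+1 + m.+1)%N by lia.
rewrite [RHS]big_split_ord /=.
under eq_bigr do rewrite mulrDr.
rewrite big_split; congr (_ + _).
rewrite (reindex_inj rev_ord_inj); apply: eq_bigr => j _ /=.
have le_jm : (j <= m)%N by rewrite -ltnS.
have hj : (m.+1 + j = (2 * m).+1 - (m - j))%N by lia.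
have -> : (m.+1 - j.+1 = m - j)%N by lia.
have -> : (-1) ^+ (m.+1 + j) = - (-1) ^+ (m - j) :> R.
  have -> : (m.+1 + j = (2 * j + (m - j)).+1)%N by lia.
  by rewrite exprS exprD exprM sqrrN expr1n expr1n mul1r mulN1r.
by rewrite hj altcoef_sym ?leq_subr // intrN mulrNN.
Qed.

Lemma altcoef_sum0 m : ~~ odd e -> (N + e = (2 * m).+1)%N -> (0 < N)%N ->
  \sum_(j < m.+1) (-1) ^+ j * altcoef j = 0.
Proof.
move=> even_e hN N_gt0; have := altcoef_horner_half int m 1 even_e hN.
rewrite subrr expr0n -(prednK N_gt0) /= mul0r.
under eq_bigr do rewrite !expr1n intz.
by rewrite -big_distrl /= => /eqP; rewrite mulf_eq0 orbF => /eqP.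
Qed.

End AlternatingCoefficients.

(** * Summation over the powers u = q^k *)

(** With x^n taken out, the summands are a^(n-k) + a^(n+k): all powers a^0, ..., a^(2n) except the
    middle one a^n, which is the term subtracted on the right. *)
Lemma palindromic_geometric (R : comNzRingType) (x a : R) n :
  (1 - a) * \sum_(1 <= k < n.+1) (x ^+ k + (x * a ^+ 2) ^+ k) * (x * a) ^+ (n - k)
  = x ^+ n * (1 - a ^+ (2 * n + 1)) - (1 - a) * (x * a) ^+ n.
Proof.
elim: n => [|n IH]; first by rewrite big_geq // !expr0 muln0 add0n expr1; ring.
rewrite big_nat_recr //= subnn expr0 mulr1.
have -> : \sum_(1 <= k < n.+1) (x ^+ k + (x * a ^+ 2) ^+ k) * (x * a) ^+ (n.+1 - k)
 = x * a * \sum_(1 <= k < n.+1) (x ^+ k + (x * a ^+ 2) ^+ k) * (x * a) ^+ (n - k).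
  rewrite big_distrr /=; apply: eq_big_nat => k /andP[_ lekn].
  by rewrite subSn // [(x * a) ^+ _.+1]exprS; ring.
rewrite mulrDr mulrCA IH !exprD !exprM !exprMn ![_ ^+ n.+1]exprS; ring.
Qed.

Section PowerSums.
Variables (F : fieldType) (t : F).
Hypothesis t_aperiodic : forall k, t ^+ k.+1 != 1.
Let q := t ^+ 2.

Lemma one_sub_expt_neq0 k : (0 < k)%N -> 1 - t ^+ k != 0.
Proof. by case: k => // k _; rewrite subr_eq0 eq_sym. Qed.

Variables (N e m : nat).
Hypotheses (even_e : ~~ odd e) (hN : (N + e = (2 * m).+1)%N) (N_gt0 : (0 < N)%N).

Lemma altcoef_power_sum n :
  \sum_(k < m.+1) (-1) ^+ k * (altcoef N e k)%:~R
      * ((q ^+ n) ^+ k * (1 - (t * q ^+ n) ^+ (2 * m - 2 * k + 1))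
         / (1 - t ^+ (2 * m - 2 * k + 1)))
  = \sum_(1 <= k < n.+1)
      (1 - q ^+ (e * k)) * (1 - q ^+ k) ^+ N * t ^+ ((2 * m).+1 * (n - k)).
Proof.
have E k : (1 - q ^+ (e * k)) * (1 - q ^+ k) ^+ N * t ^+ ((2 * m).+1 * (n - k))
  = \sum_(j < m.+1) (-1) ^+ j * (altcoef N e j)%:~R *
      ((q ^+ k) ^+ j + (q ^+ k) ^+ ((2 * m).+1 - j)) * t ^+ ((2 * m).+1 * (n - k)).
  by rewrite -big_distrl /= altcoef_horner_half // mulnC exprM [(1 - _) * _]mulrC.
under [RHS]eq_bigr do rewrite E.
rewrite exchange_big /=.
(* The missing middle power is t^((2m+1)n) for every j, so [altcoef_sum0] allows it to be subtracted
   in each term. *)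
transitivity (\sum_(j < m.+1) ((-1) ^+ j * (altcoef N e j)%:~R
    * ((q ^+ n) ^+ j * (1 - (t * q ^+ n) ^+ (2 * m - 2 * j + 1))
       / (1 - t ^+ (2 * m - 2 * j + 1))) -
    (-1) ^+ j * (altcoef N e j)%:~R * t ^+ ((2 * m).+1 * n))).
  rewrite sumrB -big_distrl /=.
  have -> : \sum_(j < m.+1) (-1) ^+ j * (altcoef N e j)%:~R = 0 :> F.
    transitivity ((\sum_(j < m.+1) (-1) ^+ j * altcoef N e j)%:~R : F).
      rewrite rmorph_sum; apply: eq_bigr => j _ /=.
      by rewrite intrM rmorphXn rmorphN rmorph1.
    by rewrite altcoef_sum0.
  by rewrite mul0r subr0.
apply: eq_bigr => j _; have le_jm : (j <= m)%N by rewrite -ltnS.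
(* With this choice x a = t^(2m+1) is free of j, and x a^2 is the power of q paired with x. *)
set a := t ^+ (2 * m - 2 * j + 1); pose x := q ^+ j.
have a1 : 1 - a != 0 by apply: one_sub_expt_neq0; rewrite addn1.
have xa : x * a = t ^+ (2 * m).+1.
  by rewrite /x /a /q -exprM -exprD; congr (_ ^+ _); lia.
have xaa : x * a ^+ 2 = q ^+ ((2 * m).+1 - j).
  by rewrite expr2 mulrA xa /a /q -exprM -exprD; congr (_ ^+ _); lia.
have pal := palindromic_geometric _ x a n.
have -> : (t * q ^+ n) ^+ (2 * m - 2 * j + 1) = a ^+ (2 * n + 1).
  by rewrite /a /q -exprM -exprS -!exprM; congr (_ ^+ _); lia.
have -> : (q ^+ n) ^+ j = x ^+ n by rewrite exprAC.
rewrite -mulrBr.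
have -> : x ^+ n * (1 - a ^+ (2 * n + 1)) / (1 - a) - t ^+ ((2 * m).+1 * n)
  = \sum_(1 <= k < n.+1) (x ^+ k + (x * a ^+ 2) ^+ k) * (x * a) ^+ (n - k).
  by apply: (mulfI a1); rewrite pal mulrBr mulrC divfK // exprM -xa.
rewrite big_distrr; apply: eq_bigr => k _ /=.
rewrite xa xaa -!mulrA; congr (_ * (_ * (_ * _))).
  by rewrite /x exprAC [X in _ = _ + X]exprAC.
by rewrite exprM.
Qed.

End PowerSums.

(** * Rewriting the sums in Q as a kernel transform *)

Lemma divf_expD (F : fieldType) (x : F) a b : x != 0 -> x ^+ a / x ^+ (a + b) = x ^- b.
Proof. by move=> x0; rewrite exprD invfM mulVKf // expf_neq0. Qed.

Lemma zbinom_nat a b : zbinom a%:Z b%:Z = 'C(a, b)%:Z. Proof. by []. Qed.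

Lemma zbinom_neg a b : zbinom a (- b.+1%:Z) = 0. Proof. by []. Qed.

Lemma zbinom_altcoef m r k : (r < m)%N ->
  zbinom (2 * m%:Z - 2 * r%:Z - 1) k%:Z
  - zbinom (2 * m%:Z - 2 * r%:Z - 1) (k%:Z - 2 * r%:Z - 2)
  = altcoef (2 * (m - r)).-1 (2 * r + 2) k.
Proof.
move=> lt_rm.
have -> : 2 * m%:Z - 2 * r%:Z - 1 = (2 * (m - r)).-1%:Z by lia.
rewrite zbinom_nat /altcoef; congr (_ - _).
have [lt|le] := ltnP.
  by have -> : k%:Z - 2 * r%:Z - 2 = - (2 * r + 1 - k).+1%:Z by lia.
by have -> : k%:Z - 2 * r%:Z - 2 = (k - (2 * r + 2))%:Z by lia.
Qed.

Lemma zbinom_kern (F : fieldType) (x : F) m s k : (k <= s)%N -> (s <= m)%N ->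
  \sum_(i < (s - k).+1)
     ('C(m - s + i, i))%:R
     * ((zbinom (m%:Z - k%:Z - i%:Z) (s%:Z - k%:Z - i%:Z))%:~R
          * x ^ (2 * (s%:Z - k%:Z - i%:Z))
        + (zbinom (m%:Z - k%:Z - i%:Z - 1) (s%:Z - k%:Z - i%:Z - 1))%:~R
          * x ^ (2 * (s%:Z - k%:Z - i%:Z) - 1))
  = kern F x (m - s) (s - k).
Proof.
move=> le_ks le_sm; under eq_bigr do rewrite mulrDr.
rewrite big_split /kern; congr (_ + _).
  apply: eq_bigr => i _ /=; have lei := ltn_ord i.
  have -> : m%:Z - k%:Z - i%:Z = (m - s + (s - k - i))%N%:Z by lia.
  have -> : s%:Z - k%:Z - i%:Z = (s - k - i)%N%:Z by lia.
  by rewrite zbinom_nat -!pmulrn -exprM.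
case hsk : (s - k)%N => [|s'].
  rewrite big_ord1 /=.
  have -> : s%:Z - k%:Z - 0 - 1 = - 1%:Z by lia.
  by rewrite zbinom_neg mul0r mulr0.
(* The last summand has lower index -1, where [zbinom] is 0; without it the sum is x times the
   convolution for s - k - 1. *)
rewrite big_ord_recr /=.
have -> : s%:Z - k%:Z - s'.+1%:Z - 1 = - 1%:Z by lia.
rewrite zbinom_neg mul0r mulr0 addr0 big_distrr; apply: eq_bigr => i _ /=.
have lei := ltn_ord i.
have -> : m%:Z - k%:Z - i%:Z - 1 = (m - s + (s' - i))%N%:Z by lia.
have -> : s%:Z - k%:Z - i%:Z - 1 = (s' - i)%N%:Z by lia.
have -> : 2 * (s%:Z - k%:Z - i%:Z) - 1 = (2 * (s' - i)).+1%:Z by lia.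
rewrite zbinom_nat -!pmulrn -[x ^ _]/(x ^+ (2 * (s' - i)).+1) exprS exprM; ring.
Qed.

(** Stated with [zbinom] rather than [altcoef], so that [QfunE] also covers r = m, where the upper
    index is -1. *)
Definition qcoef (F : fieldType) (m r k : nat) : F :=
  (zbinom (2 * m%:Z - 2 * r%:Z - 1) k%:Z
   - zbinom (2 * m%:Z - 2 * r%:Z - 1) (k%:Z - 2 * r%:Z - 2))%:~R.

Lemma QfunE (F : fieldType) m s r (x : F) : (s <= m)%N ->
  Qfun m s r x
  = \prod_(j < s.+1) (1 - x ^+ (2 * m - 2 * j + 1))
    / ((1 - x) ^+ s * (1 - x ^+ 2) ^ (2 * s%:Z - 2 * r%:Z))
    * ktrans F x (qcoef F m r) m s.
Proof.
move=> le_sm; rewrite /Qfun; congr (_ * _); apply: eq_bigr => k _.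
by rewrite zbinom_kern // -ltnS.
Qed.

(** * The expansion of S *)

Section Expansion.
Variables (F : fieldType) (t : F).
Hypothesis t_aperiodic : forall k, t ^+ k.+1 != 1.
Let q := t ^+ 2.
Variables (m r : nat).
Hypothesis lt_rm : (r < m)%N.

(** [ktrans_sum] at y = q^n meets [altcoef_power_sum] with N = 2m-2r-1 and e = 2r+2. *)
Lemma ktrans_power_sum n :
  (1 - t ^+ (2 * n + 1)) * \sum_(s < m.+1) (-1) ^+ s *
      (((1 - q ^+ n) * (1 - q ^+ n.+1)) ^+ (m - s) * (q ^+ n) ^+ s
       * ktrans F t (qcoef F m r) m s)
  = \sum_(1 <= k < n.+1) (1 - q ^+ ((2 * r + 2) * k)) * (1 - q ^+ k) ^+ (2 * (m - r)).-1
      * t ^+ ((2 * m).+1 * (n - k)).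
Proof.
rewrite -altcoef_power_sum //; [ | by rewrite oddD oddM | by lia | by lia].
have -> : t ^+ (2 * n + 1) = t * q ^+ n by rewrite addn1 exprS exprM.
rewrite exprS ktrans_sum; apply: eq_bigr => k _.
by rewrite /qcoef zbinom_altcoef.
Qed.

Lemma SfunE n :
  Sfun (2 * m - 2 * r) n r t
  = (\sum_(1 <= k < n.+1) (1 - q ^+ ((2 * r + 2) * k))
       * (1 - q ^+ k) ^+ (2 * (m - r)).-1 * t ^+ ((2 * m).+1 * (n - k)))
    / ((1 - q ^+ (2 * r + 2)) * (1 - q) ^+ (2 * (m - r)).-1).
Proof.
rewrite big_distrl /Sfun -/q; apply: eq_bigr => k _ /=.
have -> : (2 * m - 2 * r)%N%:Z - 1 = (2 * (m - r)).-1%:Z by lia.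
have -> : (2 * m - 2 * r + 2 * r + 1 = (2 * m).+1)%N by lia.
rewrite -exprnP expr_div_n invfM; ring.
Qed.

Lemma Sfun_expansion n :
  Sfun (2 * m - 2 * r) n r t =
   \sum_(k < m.+1)
     (-1) ^+ k * Qfun m k r t
     * ((1 - t ^+ (2 * n + 1)) * (1 - q ^+ n) ^+ (m - k)
        * (1 - q ^+ n.+1) ^+ (m - k) * (1 - t) ^+ k * q ^+ (k * n))
     / ((1 - q ^+ (2 * r + 2)) * (1 - q) ^ (2 * m%:Z - 2 * k%:Z - 1)
        * \prod_(i < k.+1) (1 - t ^+ (2 * (m - i) + 1))).
Proof.
rewrite SfunE -ktrans_power_sum big_distrr big_distrl; apply: eq_bigr => s _ /=.
have le_sm : (s <= m)%N by rewrite -ltnS.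
rewrite QfunE //.
have -> : \prod_(j < s.+1) (1 - t ^+ (2 * m - 2 * j + 1))
        = \prod_(i < s.+1) (1 - t ^+ (2 * (m - i) + 1)).
  by apply: eq_bigr => j _; rewrite mulnBr.
set T := ktrans _ _ _ _ _; set P := \prod_(_ < _) _.
have P0 : P != 0.
  by apply/prodf_neq0 => i _; apply: one_sub_expt_neq0 => //; rewrite addn1.
have t0 : (1 - t) ^+ s != 0.
  by rewrite expf_neq0 // -[t]expr1 one_sub_expt_neq0.
have q0 : 1 - q != 0 by apply: one_sub_expt_neq0.
have qe0 : 1 - q ^+ (2 * r + 2) != 0.
  by rewrite /q -exprM one_sub_expt_neq0 // addn2.
(* The power of 1 - q below S is shared between the denominator of Q and that of the expansion;
   either exponent may be negative. *)
have -> : (1 - q) ^+ (2 * (m - r)).-1 =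
  (1 - q) ^ (2 * s%:Z - 2 * r%:Z) * (1 - q) ^ (2 * m%:Z - 2 * s%:Z - 1).
  rewrite -expfzDr // -[LHS]/((1 - q) ^ (2 * (m - r)).-1%:Z); congr (_ ^ _); lia.
have := expfz_neq0 (2 * s%:Z - 2 * r%:Z) q0.
have := expfz_neq0 (2 * m%:Z - 2 * s%:Z - 1) q0.
rewrite exprMn -exprM [(n * s)%N]mulnC -/q.
set A := _ ^ _; set B := _ ^ _ => A0 B0.
by field; rewrite A0 B0 P0 t0 qe0.
Qed.

Lemma one_sub_t_neq0 : 1 - t != 0.
Proof. by rewrite -[t]expr1 one_sub_expt_neq0. Qed.

Lemma one_sub_q_neq0 : 1 - q != 0.
Proof. exact: one_sub_expt_neq0. Qed.

(** Dividing each of the s + 1 factors by 1 - t makes it a geometric sum; the one surplus 1 - t goes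
    to [ktrans]. Only the power of 1 - q is left to be cancelled. *)
Lemma Qfun_prod s : (s <= m)%N ->
  Qfun m s r t = \prod_(j < s.+1) ((1 - t ^+ (2 * m - 2 * j + 1)) / (1 - t))
                 * ((1 - t) * ktrans F t (qcoef F m r) m s)
                 / (1 - q) ^ (2 * s%:Z - 2 * r%:Z).
Proof.
move=> le_sm; rewrite QfunE //.
have t1 := one_sub_t_neq0.
rewrite prodf_div prodr_const card_ord [_ ^+ s.+1]exprSr.
have := expfz_neq0 (2 * s%:Z - 2 * r%:Z) one_sub_q_neq0.
have := expf_neq0 s t1.
rewrite -/q; set A := _ ^+ s; set B := _ ^ _ => A0 B0.
by field; rewrite A0 B0 t1.
Qed.

(** The k-th factor of the product cancels the denominator of the k-th term of [ktrans], leaving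
    visibly integral terms. *)
Lemma ktrans_prod s :
  \prod_(j < s.+1) ((1 - t ^+ (2 * m - 2 * j + 1)) / (1 - t))
    * ((1 - t) * ktrans F t (qcoef F m r) m s)
  = \sum_(k < s.+1)
      (\prod_(j < s.+1 | j != k) ((1 - t ^+ (2 * m - 2 * j + 1)) / (1 - t)))
      * ((-1) ^+ (s - k) * (qcoef F m r k * kern F t (m - s) (s - k))).
Proof.
rewrite /ktrans !big_distrr; apply: eq_bigr => k _ /=.
rewrite (bigD1 k) //=; set P := \prod_(_ < _ | _) _.
have t1 := one_sub_t_neq0.
have tk : 1 - t ^+ (2 * m - 2 * k + 1) != 0 by rewrite one_sub_expt_neq0 ?addn1.
by field; rewrite t1 tk.
Qed.

(** * Interpolation nodes and values at the nodes *)

Definition node n : F := (1 - q ^+ n) * (1 - q ^+ n.+1) / (q ^+ n * (1 - q) ^+ 2).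

Lemma nodeE n :
  node n = (1 - q ^+ n) / (1 - q) * ((1 - q ^+ n.+1) / (1 - q)) * (q ^+ n)^-1.
Proof. by rewrite /node expr2 !invfM; ring. Qed.

Hypothesis t_neq0 : t != 0.

Lemma qX_neq0 n : q ^+ n != 0.
Proof. by rewrite /q -exprM expf_neq0. Qed.

(** Up to a constant the node is (q^(-n) + q^(n+1)) / (1 - q)^2, which is invariant under n -> -1 -
    n; hence the two factors with exponents j - i and i + j + 1. *)
Lemma nodeB i j : (i < j)%N ->
  node i - node j = - (q ^- j * ((1 - q ^+ (j - i)) / (1 - q))
                              * ((1 - q ^+ (i + j).+1) / (1 - q))).
Proof.
move=> lt_ij; rewrite /node.
have -> : (i + j).+1 = (i + i + (j - i)).+1 by rewrite -addnA subnKC // ltnW.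
have -> : q ^+ j = q ^+ i * q ^+ (j - i) by rewrite -exprD subnKC // ltnW.
have -> : q ^+ j.+1 = q * (q ^+ i * q ^+ (j - i)) by rewrite -exprD subnKC -?exprS // ltnW.
rewrite [q ^+ i.+1]exprS [q ^+ (i + i + _).+1]exprS (exprD q (i + i)) (exprD q i).
have := one_sub_q_neq0; have := qX_neq0 i; have := qX_neq0 (j - i).
set a := q ^+ i; set b := q ^+ (j - i) => b0 a0 q1.
by field; rewrite a0 b0 q1.
Qed.

Lemma one_sub_qX_neq0 k : (0 < k)%N -> 1 - q ^+ k != 0.
Proof. by move=> k0; rewrite /q -exprM one_sub_expt_neq0 // muln_gt0. Qed.

Lemma node_neq i j : (i < j)%N -> node i != node j.
Proof.
move=> lt_ij; rewrite -subr_eq0 nodeB // oppr_eq0 !mulf_eq0 !invr_eq0.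
rewrite (negbTE (qX_neq0 j)) (negbTE one_sub_q_neq0).
by rewrite !(negbTE (one_sub_qX_neq0 _ _)) // subn_gt0.
Qed.

Lemma nodeB_inv i j : (i < j)%N ->
  (node i - node j)^-1 = - (q ^+ j * ((1 - q) / (1 - q ^+ (j - i)))
                                   * ((1 - q) / (1 - q ^+ (i + j).+1))).
Proof. by move=> lt_ij; rewrite nodeB // invrN !invfM !invrK ![_^-1 * (1 - q)]mulrC. Qed.

(* Up to the factor [(-1)^s (1-t) (1-q)^(2r-2s)], the coefficients are the [ktrans s]. *)
Definition nodepoly : {poly F} :=
  \poly_(i < m.+1) ((-1) ^+ (m - i) * ((1 - t) * ktrans F t (qcoef F m r) m (m - i)
                       * (1 - q) ^+ (2 * i) / (1 - q) ^+ (2 * (m - r)))).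

(** The factors (1 - q)^(2i) cancel the denominators of the node powers, and q^(-nm) turns
    y^(-(m-s)) into y^s, so that [ktrans_power_sum] applies. *)
Lemma nodepoly_node n :
  nodepoly.[node n] = (1 - t) / (1 - t ^+ (2 * n + 1)) * (q ^+ n)^-1 ^+ m
     * \sum_(1 <= k < n.+1) (1 - q ^+ ((2 * r + 2) * k)) / (1 - q)
         * ((1 - q ^+ k) / (1 - q)) ^+ (2 * (m - r)).-1 * t ^+ ((2 * m).+1 * (n - k)).
Proof.
have q1 := one_sub_q_neq0.
have tn : 1 - t ^+ (2 * n + 1) != 0 by rewrite one_sub_expt_neq0 ?addn1.
(* Each summand has exactly 2(m-r) factors of the form 1 - q^i, and each receives one 1 - q as
   denominator. *)
have -> : \sum_(1 <= k < n.+1) (1 - q ^+ ((2 * r + 2) * k)) / (1 - q)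
     * ((1 - q ^+ k) / (1 - q)) ^+ (2 * (m - r)).-1 * t ^+ ((2 * m).+1 * (n - k))
  = (\sum_(1 <= k < n.+1) (1 - q ^+ ((2 * r + 2) * k))
     * (1 - q ^+ k) ^+ (2 * (m - r)).-1 * t ^+ ((2 * m).+1 * (n - k)))
    / (1 - q) ^+ (2 * (m - r)).
  rewrite big_distrl; apply: eq_bigr => k _ /=.
  have -> : (1 - q) ^+ (2 * (m - r)) = (1 - q) * (1 - q) ^+ (2 * (m - r)).-1.
    by rewrite -exprS prednK //; lia.
  by rewrite expr_div_n invfM; ring.
rewrite -ktrans_power_sum horner_poly (reindex_inj rev_ord_inj) /=.
rewrite !big_distrr big_distrl big_distrr; apply: eq_bigr => i _ /=.
have le_im : (i <= m)%N by rewrite -ltnS.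
rewrite subSS subKn // /node expr_div_n.
rewrite [(q ^+ n * (1 - q) ^+ 2) ^+ _]exprMn -[((1 - q) ^+ 2) ^+ _]exprM exprVn.
have -> : (q ^+ n) ^+ m = (q ^+ n) ^+ (m - i) * (q ^+ n) ^+ i by rewrite -exprD subnK.
have := expf_neq0 (m - i) (qX_neq0 n); have := expf_neq0 i (qX_neq0 n).
have := expf_neq0 (2 * (m - i)) q1; have := expf_neq0 (2 * (m - r)) q1.
set a := _ ^+ (2 * (m - r)); set b := _ ^+ (2 * (m - i)).
set c := _ ^+ i; set e := _ ^+ (m - i) => a0 b0 c0 e0.
by field; rewrite a0 b0 c0 e0 tn.
Qed.

End Expansion.

(** * Membership in a subring of a field, later Z[t] and the semilocal ring *)

Section Subring.
Variables (F : fieldType) (S : F -> Prop).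
Hypotheses (S1 : S 1) (SB : forall x y, S x -> S y -> S (x - y))
           (SM : forall x y, S x -> S y -> S (x * y)).

Lemma subring0 : S 0. Proof. by rewrite -(subrr 1); apply: SB. Qed.

Lemma subringN x : S x -> S (- x).
Proof. by rewrite -sub0r; apply: SB subring0. Qed.

Lemma subringD x y : S x -> S y -> S (x + y).
Proof. by move=> Sx Sy; rewrite -[y]opprK; apply: SB => //; apply: subringN. Qed.

Lemma subring_sum (I : Type) (r : seq I) (P : pred I) (f : I -> F) :
  (forall i, P i -> S (f i)) -> S (\sum_(i <- r | P i) f i).
Proof. exact: (big_ind S subring0 subringD). Qed.

Lemma subring_prod (I : Type) (r : seq I) (P : pred I) (f : I -> F) :
  (forall i, P i -> S (f i)) -> S (\prod_(i <- r | P i) f i).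
Proof. exact: (big_ind S S1 SM). Qed.

Lemma subringX x n : S x -> S (x ^+ n).
Proof. by move=> Sx; elim: n => [|n IH]; rewrite ?expr0 // exprS; apply: SM. Qed.

Lemma subring_nat n : S n%:R.
Proof. by elim: n => [|n IH]; [apply: subring0 | rewrite -natr1; apply: subringD]. Qed.

Lemma subring_int z : S z%:~R.
Proof.
by case: z => n; [apply: subring_nat | apply: subringN; apply: (subring_nat n.+1)].
Qed.

Lemma subring_geom x n : x != 1 -> S x -> S ((1 - x ^+ n) / (1 - x)).
Proof.
move=> x1 Sx; have x1' : 1 - x != 0 by rewrite subr_eq0 eq_sym.
rewrite -{1}(expr1n F n) subrXX mulrC mulKf //; apply: subring_sum => i _.
by apply: SM; apply: subringX.
Qed.

Lemma subring_kern x p s : S x -> S (kern F x p s).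
Proof.
move=> Sx; have Sd s' : S (bdiag F (x ^+ 2) p s').
  apply: subring_sum => i _; apply: SM; first exact: subring_nat.
  by apply: SM; [apply: subring_nat | do 2!apply: subringX].
by apply: subringD => //; case: s => [|s]; [apply: subring0 | apply: SM].
Qed.

(* Splitting off one node, [p = p.[w n] + p1 * ('X - w n)], and [p1] is again [S]-valued
   at the remaining nodes. *)
Lemma subring_interpolation n (p : {poly F}) (w : nat -> F) :
  (size p <= n)%N -> (forall i, (i < n)%N -> S (w i)) ->
  (forall i j, (i < j)%N -> w i != w j /\ S (w i - w j)^-1) ->
  (forall i, (i < n)%N -> S p.[w i]) -> forall k, S p`_k.
Proof.
elim: n p => [|n IH] p.
  rewrite leqn0 size_poly_eq0 => /eqP -> _ _ _ k; rewrite coef0; exact: subring0.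
move=> sz_p Sw Sinv Sp k.
have /factor_theorem [p1 Dp] : root (p - p.[w n]%:P) (w n).
  by rewrite /root !hornerE subrr.
have Ep : p = p1 * ('X - (w n)%:P) + p.[w n]%:P by rewrite -Dp subrK.
have Sp1 j : S p1`_j.
  apply: (IH p1) => // [|i lt_in|i lt_in]; last 2 first.
  - exact/Sw/ltnW.
  - have [wne Si] := Sinv i n lt_in.
    have -> : p1.[w i] = (p.[w i] - p.[w n]) * (w i - w n)^-1.
      by rewrite {1}Ep !hornerE addrK mulfK // subr_eq0.
    by apply: SM => //; apply: SB; apply: Sp; rewrite ?ltnS // ltnW.
  (* The size of a product with a monic factor is additive only for p1 nonzero. *)
  have [->|p1n0] := eqVneq p1 0; first by rewrite size_poly0.
  have : (size (p1 * ('X - (w n)%:P))%R <= n.+1)%N.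
    rewrite -Dp (leq_trans (size_polyD _ _)) // size_polyN geq_max sz_p.
    exact: leq_trans (size_polyC_leq1 _) _.
  by rewrite size_Mmonic ?monicXsubC // size_XsubC addn2.
rewrite Ep coefD mulrBr coefB coefMX coefMC coefC.
apply: subringD; last by case: ifP => _; [apply: Sp | apply: subring0].
apply: SB; last by apply: SM => //; apply: Sw.
by case: ifP => _; [apply: subring0 | apply: Sp1].
Qed.

End Subring.

(** * Integer polynomials and the semilocal ring inside the fraction field *)

Lemma polyfracB p p' : polyfrac (p - p') = polyfrac p - polyfrac p'.
Proof. exact: tofracB. Qed.

Lemma polyfracM p p' : polyfrac (p * p') = polyfrac p * polyfrac p'.
Proof. exact: tofracM. Qed.

Lemma polyfrac1 : polyfrac 1 = 1.
Proof. exact: tofrac1. Qed.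

Lemma polyfracX p n : polyfrac (p ^+ n) = polyfrac p ^+ n.
Proof. exact: tofracXn. Qed.

Lemma polyfrac_inj : injective polyfrac.
Proof. by move=> p p' /eqP; rewrite tofrac_eq => /eqP. Qed.

Lemma polyfrac_eq0 p : (polyfrac p == 0) = (p == 0).
Proof. exact: tofrac_eq0. Qed.

Lemma tvarX k : tvar ^+ k = polyfrac 'X^k.
Proof. by rewrite polyfracX. Qed.

Lemma tvar_aperiodic k : tvar ^+ k.+1 != 1.
Proof.
rewrite tvarX -polyfrac1 (inj_eq polyfrac_inj); apply/eqP => /(congr1 (coefp 0)) /=.
by rewrite coefXn coef1.
Qed.

Definition is_Zpoly (x : ratfun) := exists P, x = polyfrac P.

Lemma Zpoly1 : is_Zpoly 1.
Proof. by exists 1; rewrite polyfrac1. Qed.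

Lemma ZpolyB x y : is_Zpoly x -> is_Zpoly y -> is_Zpoly (x - y).
Proof. by move=> [P ->] [P' ->]; exists (P - P'); rewrite polyfracB. Qed.

Lemma ZpolyM x y : is_Zpoly x -> is_Zpoly y -> is_Zpoly (x * y).
Proof. by move=> [P ->] [P' ->]; exists (P * P'); rewrite polyfracM. Qed.

Lemma Zpoly_tvar : is_Zpoly tvar.
Proof. by exists 'X. Qed.

Definition semilocal_den (g : {poly int}) := (g.[1] != 0) && (g.[-1] != 0).

(* The semilocal ring of fractions without pole at [1] and [-1]. *)
Definition is_semilocal (x : ratfun) :=
  exists f g, semilocal_den g /\ x * polyfrac g = polyfrac f.

Lemma semilocal_denM g g' :
  semilocal_den g -> semilocal_den g' -> semilocal_den (g * g').
Proof.
by rewrite /semilocal_den !hornerM !mulf_eq0 !negb_or => /andP[-> ->] /andP[-> ->].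
Qed.

Lemma semilocal_den_neq0 g : semilocal_den g -> polyfrac g != 0.
Proof.
rewrite polyfrac_eq0; apply: contraTneq => ->.
by rewrite /semilocal_den horner0 eqxx.
Qed.

Lemma Zpoly_semilocal x : is_Zpoly x -> is_semilocal x.
Proof.
move=> [P ->]; exists P, 1; rewrite polyfrac1 mulr1; split=> //.
by rewrite /semilocal_den !hornerC.
Qed.

Lemma semilocal1 : is_semilocal 1.
Proof. exact/Zpoly_semilocal/Zpoly1. Qed.

Lemma semilocalB x y : is_semilocal x -> is_semilocal y -> is_semilocal (x - y).
Proof.
move=> [f [g [dg Dx]]] [f' [g' [dg' Dy]]].
exists (f * g' - f' * g), (g * g'); split; first exact: semilocal_denM.
by rewrite polyfracB !polyfracM -Dx -Dy; ring.
Qed.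

Lemma semilocalM x y : is_semilocal x -> is_semilocal y -> is_semilocal (x * y).
Proof.
move=> [f [g [dg Dx]]] [f' [g' [dg' Dy]]].
exists (f * f'), (g * g'); split; first exact: semilocal_denM.
by rewrite !polyfracM -Dx -Dy; ring.
Qed.

Lemma semilocal_inv g : semilocal_den g -> is_semilocal (polyfrac g)^-1.
Proof.
move=> dg; exists 1, g; split=> //.
by rewrite polyfrac1 mulVf // semilocal_den_neq0.
Qed.

(** Since g vanishes at neither 1 nor -1, both are roots of P. The linear factors are monic, so the
    factor theorem works over the integers, and 1 - X^2 is removed one power at a time. *)
Lemma dvd_of_semilocal e (f P : {poly int}) g :
  semilocal_den g -> f * (1 - 'X ^+ 2) ^+ e = P * g ->
  exists P', P = P' * (1 - 'X ^+ 2) ^+ e.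
Proof.
move=> dg; elim: e f P => [|e IH] f P E; first by exists P; rewrite expr0 mulr1.
have root_of a (Q : {poly int}) : g.[a] != 0 -> (Q * g).[a] = 0 -> root Q a.
  by rewrite hornerM => ga /eqP; rewrite mulf_eq0 (negbTE ga) orbF.
have /andP[g1 gN1] := dg.
have /factor_theorem [P1 DP] : root P 1.
  by apply: root_of => //; rewrite -E !hornerE /= exprS; ring.
have /factor_theorem [P2 DP1] : root P1 (-1).
  have : root P (-1) by apply: root_of => //; rewrite -E !hornerE /= exprS; ring.
  by rewrite DP rootM root_XsubC orbF.
have X2 : ('X - (-1)%:P) * ('X - 1%:P) = - (1 - 'X ^+ 2) :> {poly int}.
  by rewrite polyCN; ring.
have nz : (1 - 'X ^+ 2 : {poly int}) != 0.
  apply/eqP => /(congr1 (coefp 0)) /=; rewrite coefB coef1 coefXn coef0; lia.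
(* The sign arises because the two monic linear factors multiply to -(1 - X^2). *)
have [P' DP2] : exists P', - P2 = P' * (1 - 'X ^+ 2) ^+ e.
  apply: (IH f); apply: (mulIf nz); rewrite -mulrA -exprSr E DP DP1 -mulrA.
  by rewrite -[P2 * _ * _]mulrA X2; ring.
exists P'; rewrite exprSr mulrA -DP2 DP DP1 -mulrA X2; ring.
Qed.

Lemma semilocal_Zpoly x e :
  is_semilocal x -> is_Zpoly (x * (1 - tvar ^+ 2) ^+ e) -> is_Zpoly x.
Proof.
move=> [f [g [dg Dx]]] [P DP].
have Dt : (1 - tvar ^+ 2) ^+ e = polyfrac ((1 - 'X ^+ 2) ^+ e).
  by rewrite polyfracX polyfracB polyfrac1 tvarX.
have [|P' DP'] := dvd_of_semilocal e f P g dg.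
  by apply: polyfrac_inj; rewrite !polyfracM -Dt -Dx -DP; ring.
exists P'; apply: (@mulIf _ ((1 - tvar ^+ 2) ^+ e)).
  by rewrite expf_neq0 // one_sub_expt_neq0 //; apply: tvar_aperiodic.
by rewrite DP DP' polyfracM Dt.
Qed.

(** * Integrality of Q *)

Section Integrality.
Let t := tvar.
Let q := t ^+ 2.

Lemma semilocal_tvar : is_semilocal t.
Proof. exact/Zpoly_semilocal/Zpoly_tvar. Qed.

Lemma semilocal_tvarX k : is_semilocal (t ^+ k).
Proof. exact: (subringX _ _ semilocal1 semilocalM _ _ semilocal_tvar). Qed.

Lemma semilocal_tvar_inv : is_semilocal t^-1.
Proof. by apply: semilocal_inv; rewrite /semilocal_den !hornerE. Qed.

Lemma tvar_neq1 : t != 1.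
Proof. exact: tvar_aperiodic 0. Qed.

Lemma qvar_neq1 : q != 1.
Proof. exact: tvar_aperiodic 1. Qed.

Lemma semilocal_qgap k : is_semilocal ((1 - q ^+ k) / (1 - q)).
Proof.
apply: (subring_geom _ _ semilocal1 semilocalB semilocalM) qvar_neq1 _.
exact: semilocal_tvarX.
Qed.

Lemma polyfrac_geom (p : {poly int}) k : p != 1 ->
  (1 - polyfrac p ^+ k) / (1 - polyfrac p) = polyfrac (\sum_(i < k) p ^+ i).
Proof.
move=> p1; rewrite -polyfracX -polyfrac1 -!polyfracB.
have -> : 1 - p ^+ k = (1 - p) * \sum_(i < k) p ^+ i.
  rewrite -{1}(expr1n _ k) subrXX; congr (_ * _).
  by apply: eq_bigr => i _; rewrite expr1n mul1r.
by rewrite polyfracM mulrC mulKf // polyfrac_eq0 subr_eq0 eq_sym.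
Qed.

Lemma horner_geom (p : {poly int}) k a :
  (\sum_(i < k) p ^+ i).[a] = \sum_(i < k) p.[a] ^+ i.
Proof. by rewrite horner_sum; apply: eq_bigr => i _; rewrite horner_exp. Qed.

(** At t = 1 and t = -1 one has q = 1, and the geometric sum takes the nonzero value k. *)
Lemma semilocal_qgap_inv k : (0 < k)%N -> is_semilocal ((1 - q) / (1 - q ^+ k)).
Proof.
move=> k_gt0; rewrite -invf_div [q]tvarX polyfrac_geom; last first.
  by apply: contraNneq qvar_neq1 => E; rewrite /q tvarX E polyfrac1.
apply: semilocal_inv; rewrite /semilocal_den !horner_geom !hornerXn sqrrN expr1n.
by under eq_bigr do rewrite expr1n; rewrite sumr_const card_ord andbb; lia.
Qed.

(** The geometric sum is 2n+1 at t = 1 and, its length being odd, 1 at t = -1. *)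
Lemma semilocal_tgap_inv n : is_semilocal ((1 - t) / (1 - t ^+ (2 * n + 1))).
Proof.
rewrite -invf_div polyfrac_geom; last first.
  by apply: contraNneq tvar_neq1 => E; rewrite /t /tvar E polyfrac1.
apply: semilocal_inv; rewrite /semilocal_den !horner_geom !hornerX.
apply/andP; split.
  by under eq_bigr do rewrite expr1n; rewrite sumr_const card_ord; lia.
suff -> : \sum_(i < 2 * n + 1) (-1) ^+ i = 1 :> int by [].
elim: n => [|n IH]; first by rewrite big_ord1.
have -> : (2 * n.+1 + 1 = (2 * n + 1).+2)%N by lia.
by rewrite !big_ord_recr /= IH exprS; ring.
Qed.

Lemma semilocal_qinvX n : is_semilocal (q ^+ n)^-1.
Proof.
rewrite -!exprVn; apply: (subringX _ _ semilocal1 semilocalM).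
exact: (subringX _ _ semilocal1 semilocalM _ _ semilocal_tvar_inv).
Qed.

Lemma semilocal_node n : is_semilocal (node ratfun t n).
Proof.
rewrite nodeE; apply: semilocalM; last exact: semilocal_qinvX.
by apply: semilocalM; apply: semilocal_qgap.
Qed.

Lemma t_neq0 : t != 0.
Proof. by rewrite /t /tvar polyfrac_eq0 polyX_eq0. Qed.

Lemma semilocal_nodes i j : (i < j)%N ->
  node ratfun t i != node ratfun t j
  /\ is_semilocal (node ratfun t i - node ratfun t j)^-1.
Proof.
move=> lt_ij.
split; first exact: node_neq tvar_aperiodic t_neq0 _ _ lt_ij.
rewrite (nodeB_inv _ _ tvar_aperiodic t_neq0 _ _ lt_ij).
apply: (subringN _ _ semilocal1 semilocalB).
apply: semilocalM; last exact: semilocal_qgap_inv.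
apply: semilocalM; first by rewrite -exprM; apply: semilocal_tvarX.
by apply: semilocal_qgap_inv; rewrite subn_gt0.
Qed.

Section Coefficients.
Variables m r : nat.
Let T := ktrans ratfun t (qcoef ratfun m r) m.

Lemma Zpoly_kernel_transform s : (s <= m)%N ->
  is_Zpoly (\prod_(j < s.+1) ((1 - t ^+ (2 * m - 2 * j + 1)) / (1 - t))
            * ((1 - t) * T s)).
Proof.
move=> le_sm; rewrite /T ktrans_prod; last exact: tvar_aperiodic.
apply: (subring_sum _ _ Zpoly1 ZpolyB) => k _; apply: ZpolyM.
  apply: (subring_prod _ _ Zpoly1 ZpolyM) => j _.
  exact: (subring_geom _ _ Zpoly1 ZpolyB ZpolyM) tvar_neq1 Zpoly_tvar.
apply: ZpolyM.
  apply: (subringX _ _ Zpoly1 ZpolyM); exact: (subringN _ _ Zpoly1 ZpolyB _ Zpoly1).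
apply: ZpolyM; first exact: (subring_int _ _ Zpoly1 ZpolyB).
exact: (subring_kern _ _ Zpoly1 ZpolyB ZpolyM) Zpoly_tvar.
Qed.

Lemma semilocal_kernel_transform s : (r < m)%N -> (s <= m)%N ->
  is_semilocal ((1 - t) * T s * (1 - q) ^+ (2 * (m - s)) / (1 - q) ^+ (2 * (m - r))).
Proof.
move=> lt_rm le_sm.
have hp n : is_semilocal (nodepoly ratfun t m r).[node ratfun t n].
  rewrite nodepoly_node //; [ | exact: tvar_aperiodic | exact: t_neq0].
  apply: semilocalM; first apply: semilocalM.
  - exact: semilocal_tgap_inv.
  - exact: (subringX _ _ semilocal1 semilocalM _ _ (semilocal_qinvX n)).
  - apply: (subring_sum _ _ semilocal1 semilocalB) => k _.
    apply: semilocalM; last exact: semilocal_tvarX.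
    apply: semilocalM; first exact: semilocal_qgap.
    exact: (subringX _ _ semilocal1 semilocalM _ _ (semilocal_qgap k)).
have := subring_interpolation _ _ semilocal1 semilocalB semilocalM m.+1
  (nodepoly ratfun t m r) (node ratfun t) (size_poly _ _)
  (fun i _ => semilocal_node i) semilocal_nodes (fun i _ => hp i) (m - s)%N.
rewrite coef_poly ltnS leq_subr subKn // -/T.
(* The coefficient of index m - s carries the sign (-1)^s, removed by a second such factor. *)
move/(semilocalM _ _ (Zpoly_semilocal _ (subring_int _ _ Zpoly1 ZpolyB ((-1) ^+ s)))).
by rewrite rmorphXn rmorphN rmorph1 signrMK.
Qed.

Lemma Qfun_Zpoly s : (s <= m)%N -> is_Zpoly (Qfun m s r t).
Proof.
move=> le_sm; have ZT := Zpoly_kernel_transform s le_sm.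
have q1 := one_sub_q_neq0 _ _ tvar_aperiodic; rewrite (Qfun_prod _ _ tvar_aperiodic) //.
rewrite -/T -/q in q1 *.
have [le_sr|lt_rs] := leqP s r.
  rewrite invr_expz; apply: ZpolyM => //.
  have -> : - (2 * s%:Z - 2 * r%:Z) = (2 * (r - s))%N%:Z by lia.
  apply: (subringX _ _ Zpoly1 ZpolyM); apply: ZpolyB; first exact: Zpoly1.
  exact: (subringX _ _ Zpoly1 ZpolyM _ _ Zpoly_tvar).
have -> : 2 * s%:Z - 2 * r%:Z = (2 * (s - r))%N%:Z by lia.
apply: (semilocal_Zpoly _ (2 * (s - r))); last first.
  by rewrite divfK; [exact: ZT | exact: expf_neq0 q1].
have lt_rm : (r < m)%N by apply: leq_trans le_sm.
have := semilocal_kernel_transform s lt_rm le_sm.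
have -> : (2 * (m - r) = 2 * (m - s) + 2 * (s - r))%N by lia.
rewrite -[_ * _ / _]mulrA (divf_expD _ _ _ _ q1) => loc; rewrite -mulrA.
apply: semilocalM loc.
apply: (subring_prod _ _ semilocal1 semilocalM) => j _.
exact: (subring_geom _ _ semilocal1 semilocalB semilocalM) tvar_neq1 semilocal_tvar.
Qed.

End Coefficients.
End Integrality.

Theorem theorem5p2 (m r n : nat) :
  (r <= m)%N -> (1 <= m)%N -> (1 <= n)%N ->
  (forall s : nat, (s <= m)%N ->
     exists P : {poly int}, Qfun m s r tvar = polyfrac P)
  /\
  ((r < m)%N ->
   let t := tvar in
   let q := t ^+ 2 in
   Sfun (2 * m - 2 * r) n r t =
   \sum_(k < m.+1)
     (-1) ^+ k * Qfun m k r t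
     * ((1 - t ^+ (2 * n + 1)) * (1 - q ^+ n) ^+ (m - k)
        * (1 - q ^+ n.+1) ^+ (m - k) * (1 - t) ^+ k * q ^+ (k * n))
     / ((1 - q ^+ (2 * r + 2)) * (1 - q) ^ (2 * m%:Z - 2 * k%:Z - 1)
        * \prod_(i < k.+1) (1 - t ^+ (2 * (m - i) + 1)))).
Proof.
move=> _ _ _; split; first by move=> s; apply: Qfun_Zpoly.
by move=> lt_rm t q; apply: Sfun_expansion => //; apply: tvar_aperiodic.
Qed.
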